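(* Let $W$ be a $2$-step stochastic block model graphon with steps $A,B$ of respective sizes $p$ and $1-p$, where $p\le\frac12$, with edge density $q_0$ within each block and $q_1$ across the two blocks, where $q_0>q_1$. Let $G$ be a graph on $[n]$ sampled from $\mathbb{G}(n,W)$, let $k\ge 2$, and let $\{C_1,\dots,C_k\}$ be a partition of the vertices $[n]$ of $G$ into $k$ classes. Suppose $\tau>1-\frac{1}{4k}$ (with $\tau<1$) and that the partition $\{C_1,\dots,C_k\}$ correctly classifies at least $\tau n$ many vertices. If $\tau'>\tau$, then for every $\epsilon>0$ and every $\xi>0$ (with $\tau'+\xi<1$) such that (i) $\displaystyle q_0-q_1 \ge \frac{3-(1-4k(1-\tau))^{1/2}}{\tau}-2+4\epsilon+\frac{1-(1-4k(1-\tau))^{1/2}}{n\,\tau\,(1-\tau)}$, and (ii) $\displaystyle \epsilon^2 n > -12k\,\log\Bigl(\frac{1-(\tau'+\xi)^{1/k}}{2}\Bigr)$, the partition obtained by applying one iteration of the random-centroid variant of ISFE to $\{C_1,\dots,C_k\}$ correctly classifies at least $\tau' n$ many vertices with probability at least $$\bigl(1-p^k-(1-p)^k\bigr)\Bigl(1-2\exp\Bigl\{-\frac{\epsilon^2 n}{12k}\Bigr\}\Bigr)^{k^2}\Bigl(1-2\exp\Bigl\{-\frac{\xi^2 n}{3}\Bigr\}\Bigr).$$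
   Context: Notation: $[n]=\{1,\dots,n\}$. A graphon is a symmetric measurable function $W:[0,1]^2\to[0,1]$. The random graph $\mathbb{G}(n,W)$ on $[n]$ is sampled by taking $U_1,\dots,U_n$ i.i.d. uniform on $[0,1]$ and, given these, including each edge $\{i,j\}$, $i<j$, independently with probability $W(U_i,U_j)$ (graphs are simple and undirected; $G_{ij}\in\{0,1\}$ is the adjacency matrix). The $2$-step stochastic block model graphon is $W(x,y)=q_0$ if $x,y$ both lie in $A$ or both lie in $B$, and $W(x,y)=q_1$ otherwise, where $A,B$ partition $[0,1]$ into pieces of lengths $p$ and $1-p$, and $q_0,q_1\in[0,1]$. Blocks: $[n]_A=\{x\in[n]: U_x\in A\}$ and $[n]_B=\{x\in[n]:U_x\in B\}$. Correct classification: for a class $C$ of a partition of $[n]$, its majority is $C^*=[n]_A\cap C$ if $|[n]_A\cap C|\ge|[n]_B\cap C|$, and $C^*=[n]_B\cap C$ otherwise. A vertex $x\in C$ is correctly classified by the partition if $x\in C^*$. Edge densities: for nonempty $X,Y\subseteq[n]$, $e_G(X,Y)=\frac{1}{|X||Y|}\sum_{i\in X}\sum_{j\in Y}G_{ij}$; write $e_G(x,Y)$ for $e_G(\{x\},Y)$. The weighted edge-density vector of a vertex $x$ with respect to the partition $\{C_1,\dots,C_k\}$ is $$e_x=\Bigl[\tfrac{|C_1|}{n}e_G(x,C_1),\dots,\tfrac{|C_k|}{n}e_G(x,C_k)\Bigr].$$ One iteration of the random-centroid variant of ISFE (iterative step-function estimation), starting from $\{C_1,\dots,C_k\}$: select $k$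 centroids uniformly at random from $[n]$ without replacement; each centroid starts its own new class (bin); then assign every remaining vertex $x$ to the bin whose centroid's weighted edge-density vector is closest in $L^1$ to $e_x$, breaking ties uniformly and independently at random. The resulting $k$ bins form the new partition. The initial partition is regarded as given; probability refers to the randomness in sampling $G$ and in the random choices (centroids, ties) of the ISFE iteration. *)

(* Defs.v *)
From HB Require Import structures.
From mathcomp Require Import all_boot all_order all_algebra.
From mathcomp Require Import all_classical all_reals all_analysis.

Set Implicit Arguments.
Unset Strict Implicit.
Unset Printing Implicit Defensive.

Import Order.TTheory GRing.Theory Num.Theory.
Import numFieldNormedType.Exports.

Local Open Scope classical_set_scope.
Local Open Scope ring_scope.

Section Graphons.
Variable R : realType.

Definition unit_interval : set R := `[0, 1]%classic.

(* W is a total function on R * R; only its values on [0,1]^2 matter. *)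
Record graphon (W : R -> R -> R) : Prop := Graphon {
  graphon_sym : forall x y, unit_interval x -> unit_interval y -> W x y = W y x;
  graphon_measurable :
    measurable_fun (unit_interval `*` unit_interval) (fun z : R * R => W z.1 z.2);
  graphon_range : forall x y, unit_interval x -> unit_interval y -> 0 <= W x y <= 1 }.

(* The steps A and B may be arbitrary measurable sets, not only intervals. *)
Record sbm_graphon (A B : set R) (p q0 q1 : R) (W : R -> R -> R) : Prop :=
  SbmGraphon {
    sbm_is_graphon : graphon W;
    sbm_measA : measurable A;
    sbm_measB : measurable B;
    sbm_cover : A `|` B = unit_interval;
    sbm_disjoint : A `&` B = set0;
    sbm_sizeA : @lebesgue_measure R A = p%:E;
    sbm_sizeB : @lebesgue_measure R B = (1 - p)%:E;
    sbm_q0 : 0 <= q0 <= 1;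
    sbm_q1 : 0 <= q1 <= 1;
    sbm_val : forall x y, unit_interval x -> unit_interval y ->
      W x y = if (x \in A) && (y \in A) || (x \in B) && (y \in B)
              then q0 else q1 }.

End Graphons.

Section Classification.
Variables (R : realType) (n : nat).
Implicit Types (u : 'I_n -> R) (A B : set R) (C : {set 'I_n}).

Definition block u A : {set 'I_n} := [set i : 'I_n | u i \in A]%SET.

Definition majority A B u C : {set 'I_n} :=
  if (#|block u B :&: C| <= #|block u A :&: C|)%N
  then block u A :&: C else block u B :&: C.

Definition num_correct A B u (P : {set {set 'I_n}}) : nat :=
  #|[set x : 'I_n | x \in majority A B u (finset.pblock P x)]%SET|.

End Classification.

Section Iteration.
Variables (R : realType) (n : nat).
Implicit Types (g : 'M[bool]_n) (P : {set {set 'I_n}}) (x y : 'I_n).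
Implicit Types (S X Y C : {set 'I_n}) (f : {ffun 'I_n -> 'I_n}).

Definition simple_graph g : bool :=
  [forall i, [forall j, g i j == g j i]] && [forall i, ~~ g i i].

Definition edge_density g X Y : R :=
  (\sum_(i in X) \sum_(j in Y) (g i j)%:R) / (#|X|%:R * #|Y|%:R).

(* The coordinates of the weighted edge-density vector of x are indexed by the
   classes themselves. *)
Definition weighted_density g x C : R :=
  #|C|%:R / n%:R * edge_density g [set x]%SET C.

Definition L1_dist P g x y : R :=
  \sum_(C in P) `|weighted_density g x C - weighted_density g y C|.

(* S is the set of centroids. *)
Definition nearest P g S x : {set 'I_n} :=
  [set c in S | [forall c' in S, L1_dist P g x c <= L1_dist P g x c']]%SET.

(* An outcome of the assignment step is a function f sending each vertex to the
   centroid of its bin. Given the partition, the graph and the centroids, the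
   values f x are independent: a centroid opens its own bin, and any other
   vertex picks uniformly among its nearest centroids. *)
Definition assignment_pmf P g S f : R :=
  \prod_x (if x \in S then (f x == x)%:R
           else if f x \in nearest P g S x then #|nearest P g S x|%:R^-1
           else 0).

Definition bins f : {set {set 'I_n}} := finset.preim_partition f [set: 'I_n]%SET.

Definition centroids_pmf (k : nat) S : R :=
  if #|S| == k then 'C(n, k)%:R^-1 else 0.

(* Law of G(n, W) given the latent positions u. *)
Definition graph_pmf (W : R -> R -> R) (u : 'I_n -> R) g : R :=
  if simple_graph g then
    \prod_(i < n) \prod_(j < n | (i < j)%N)
      (if g i j then W (u i) (u j) else 1 - W (u i) (u j))
  else 0.

End Iteration.

Section Laws.
Context {R : realType} {d : measure_display} {T : measurableType d}.
Variable (Pr : probability T R).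

Definition finite_rv (F : finType) (X : T -> F) : Prop :=
  forall a, measurable (X @^-1` [set a]).

Definition mutually_independent (n : nat) (U : 'I_n -> {RV Pr >-> R}) : Prop :=
  forall (J : {set 'I_n}) (D : 'I_n -> set R), (forall i, measurable (D i)) ->
    Pr (\bigcap_(i in [set` J]) U i @^-1` D i) =
    (\prod_(i in J) Pr (U i @^-1` D i))%E.

Definition iid_uniform (n : nat) (U : 'I_n -> {RV Pr >-> R}) : Prop :=
  mutually_independent U /\
  forall i D, measurable D ->
    distribution Pr (U i) D = uniform_prob (@ltr01 R) D.

Section ISFE.
Variables (n : nat) (U : 'I_n -> {RV Pr >-> R}).
Variables (C : T -> {set {set 'I_n}}) (G : T -> 'M[bool]_n).
Variables (S : T -> {set 'I_n}) (F : T -> {ffun 'I_n -> 'I_n}).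

Definition latent_in (D : 'I_n -> set R) : set T :=
  [set w | forall i, D i (U i w)].

(* G is drawn from G(n, W) with latent positions U. The initial partition C is
   given independently of the sampling of the edges: it may depend on U (so that
   its number of correctly classified vertices can be prescribed), but given U
   it carries no information on the edges. The identity below says that
   graph_pmf W U is the conditional law of G given (U, C); it is enough to test
   it on rectangles, which form a pi-system. *)
Definition sampled_graph (W : R -> R -> R) : Prop :=
  finite_rv C /\ finite_rv G /\
  forall (D : 'I_n -> set R) P g, (forall i, measurable (D i)) ->
    Pr (latent_in D `&` C @^-1` [set P] `&` G @^-1` [set g]) =
    (\int[Pr]_(w in latent_in D `&` C @^-1` [set P])
       (graph_pmf W (fun i => U i w) g)%:E)%E.

(* S is a uniform k-subset of the vertices, independent of (U, C, G). *)
Definition random_centroids (k : nat) : Prop :=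
  finite_rv S /\
  forall (D : 'I_n -> set R) P g s, (forall i, measurable (D i)) ->
    Pr (latent_in D `&` C @^-1` [set P] `&` G @^-1` [set g]
        `&` S @^-1` [set s]) =
    (Pr (latent_in D `&` C @^-1` [set P] `&` G @^-1` [set g])
     * (centroids_pmf R k s)%:E)%E.

(* assignment_pmf C G S is the conditional law of F given (U, C, G, S). *)
Definition random_assignment : Prop :=
  finite_rv F /\
  forall (D : 'I_n -> set R) P g s f, (forall i, measurable (D i)) ->
    Pr (latent_in D `&` C @^-1` [set P] `&` G @^-1` [set g]
        `&` S @^-1` [set s] `&` F @^-1` [set f]) =
    (Pr (latent_in D `&` C @^-1` [set P] `&` G @^-1` [set g]
         `&` S @^-1` [set s])
     * (assignment_pmf R P g s f)%:E)%E.

End ISFE.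
End Laws.

(* Main.v *)
(** Condition on the block assignment [b], the partition [P] and the centroids
    [s]; then only the edges and the ties are random. For a vertex [x], let
    N(x) be the sum over the classes of the absolute deviations of the number
    of neighbours of [x] in the class from its mean. Writing the absolute
    values as signs and bounding the moment generating function of each of the
    [2^k] signed sums, N(x) >= eps n has probability at most
    [beta = 2^k exp(- eps^2 n / 2)]. Since a classification with few errors
    makes the blocks unbalanced in most classes, (i) ensures that, as soon as x
    and all centroids have small deviation and both blocks contain a centroid,
    x joins a centroid of its own block. A union bound over the centroids and
    Markov's inequality for the number of vertices of large deviation leave a
    failure probability of at most [k beta + beta / (1 - tau')]. With
    [a = exp(- eps^2 n / (12 k))] one has [beta = (2 a^6)^k], while (ii) gives
    [2 a < 1 - tau'], so that this is at most [2 a]. The centroids are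
    independent of the latent positions, so both blocks contain one with
    probability [1 - p^k - (1-p)^k], and the success probability is at least
    [(1 - p^k - (1-p)^k) (1 - 2 a)], which dominates the claimed bound. *)

Require Import Defs.
From HB Require Import structures.
From mathcomp Require Import all_boot all_order all_algebra.
From mathcomp Require Import all_classical all_reals all_analysis.
From mathcomp Require Import ring lra zify.

Set Implicit Arguments.
Unset Strict Implicit.
Unset Printing Implicit Defensive.

Import Order.TTheory GRing.Theory Num.Theory.
Import numFieldNormedType.Exports.

Local Open Scope classical_set_scope.
Local Open Scope ring_scope.

(** * Concentration of densities in an inhomogeneous random graph *)

Section RandomGraph.
Context {R : realType} {n : nat}.
Implicit Types (w : 'I_n -> 'I_n -> R) (g : 'M[bool]_n) (x y i j : 'I_n).

Definition edge_pmf w g : R :=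
  if simple_graph g then
    \prod_(i < n) \prod_(j < n | (i < j)%N) (if g i j then w i j else 1 - w i j)
  else 0.

Lemma simple_graphP g :
  simple_graph g -> (forall i j, g i j = g j i) /\ (forall i, g i i = false).
Proof.
case/andP=> /forallP s /forallP d; split=> [i j|i]; last exact/negbTE/d.
by have /forallP/(_ j)/eqP := s i.
Qed.

(** A simple graph is freely determined by its entries above the diagonal, so a sum of products over
    graphs is a product of sums over pairs. This is how independence of the edges enters. *)
Lemma sum_simple_graphs (f : 'I_n -> 'I_n -> bool -> R) :
  \sum_(g : 'M[bool]_n | simple_graph g)
    \prod_(i < n) \prod_(j < n | (i < j)%N) f i j (g i j) =
  \prod_(i < n) \prod_(j < n | (i < j)%N) (f i j true + f i j false).
Proof.
(* Off the pairs [i < j] the weight is 1 for [false] and 0 for [true]: such pairs contribute a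
   factor 1, and functions that are [true] there drop out. *)
pose psi (e : 'I_n * 'I_n) b := if (e.1 < e.2)%N then f e.1 e.2 b else (~~ b)%:R.
transitivity (\prod_(e : 'I_n * 'I_n) \sum_(b : bool) psi e b); last first.
  rewrite pair_big_dep /= [RHS]big_mkcond /=; apply: eq_bigr => e _.
  by rewrite big_bool /psi; case: ifP => //= _; rewrite add0r.
rewrite bigA_distr_bigA.
pose upper (h : {ffun 'I_n * 'I_n -> bool}) := [forall e, h e ==> (e.1 < e.2)%N].
rewrite (bigID upper) /= [X in _ + X]big1 ?addr0; last first.
  move=> h /forallPn[e]; rewrite negb_imply => /andP[he lt].
  by rewrite (bigD1 e) //= /psi (negbTE lt) he mul0r.
pose h_of g := [ffun e : 'I_n * 'I_n => (e.1 < e.2)%N && g e.1 e.2].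
pose g_of (h : {ffun 'I_n * 'I_n -> bool}) : 'M[bool]_n :=
  \matrix_(i, j) (h (i, j) || h (j, i)).
rewrite [RHS](reindex_onto h_of g_of) /=; last first.
  move=> h /forallP hu; apply/ffunP => -[i j]; rewrite ffunE /= mxE.
  have := hu (i, j); have := hu (j, i) => /=.
  case: (h (i, j)); case: (h (j, i)); rewrite ?andbF ?andbT //=.
  by move=> /ltnW ji _; rewrite ltnNge ji.
apply: eq_big => [g|g gs].
  apply/idP/andP => [/simple_graphP[gs gd]|[_ /eqP <-]].
    split; first by apply/forallP => e; rewrite ffunE; apply/implyP => /andP[].
    apply/eqP/matrixP => i j; rewrite mxE !ffunE /= (gs j i) -andb_orl.
    by case: ltngtP => //= /val_inj ->; rewrite gd.
  rewrite /simple_graph; apply/andP; split; apply/forallP => i.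
    by apply/forallP => j; rewrite !mxE orbC.
  by rewrite !mxE !ffunE /= ltnn.
rewrite pair_big_dep /= big_mkcond /=; apply: eq_bigr => e _.
by rewrite /psi ffunE; case: ifP.
Qed.

Lemma sum_edge_pmf w : \sum_g edge_pmf w g = 1.
Proof.
rewrite /edge_pmf -big_mkcond /=.
rewrite (sum_simple_graphs (fun i j b => if b then w i j else 1 - w i j)).
by rewrite big1 // => i _; rewrite big1 // => j _; rewrite addrC subrK.
Qed.

Lemma edge_pmf_ge0 w g :
  (forall i j, 0 <= w i j <= 1) -> 0 <= edge_pmf w g.
Proof.
move=> w01; rewrite /edge_pmf; case: ifP => // _.
apply: prodr_ge0 => i _; apply: prodr_ge0 => j _.
by have /andP[] := w01 i j; case: ifP => //; rewrite subr_ge0.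
Qed.

(** Every [y != x] forms exactly one pair [i < j] with [x]. In this shape a product over the
    possible neighbours of [x] merges with [edge_pmf]. *)
Lemma prod_incident_pairs x (h : 'I_n -> R) :
  \prod_(y | y != x) h y =
  \prod_(i < n) \prod_(j < n | (i < j)%N)
    (if i == x then h j else if j == x then h i else 1).
Proof.
have split1 i j : (i < j)%N ->
    (if i == x then h j else if j == x then h i else 1) =
    (if i == x then h j else 1) * (if j == x then h i else 1).
  case: eqP => [->|_ _]; last by rewrite mul1r.
  by case: eqP => [->|_]; rewrite ?ltnn // mulr1.
rewrite (eq_bigr _ (fun i _ => eq_bigr _ (split1 i))).
rewrite (eq_bigr _ (fun i _ => big_split _ _ _ _ _)) /=.
rewrite big_split /= [X in _ = X * _](bigD1 x) //=.
rewrite [X in _ = _ * X * _]big1 ?mulr1; last first.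
  by move=> i /negbTE ne; rewrite big1 // => j _; rewrite ne.
under [X in _ = _ * X]eq_bigr => i _ do rewrite big_mkcond /=.
rewrite exchange_big /= [X in _ = _ * X](bigD1 x) //=.
rewrite [X in _ = _ * (_ * X)]big1 ?mulr1; last first.
  by move=> j /negbTE ne; rewrite big1 // => i _; rewrite ne if_same.
rewrite eqxx (bigID (fun y : 'I_n => (x < y)%N)) /=; congr (_ * _).
  rewrite [RHS]big_mkcond [LHS]big_mkcond; apply: eq_bigr => y _ /=.
  by case: eqP => //= ->; rewrite ltnn.
rewrite [LHS]big_mkcond; apply: eq_bigr => y _ /=.
by rewrite -leqNgt ltn_neqAle.
Qed.

(** From [expR (- x) >= 1 - x] one gets [expR x <= (1 - x)^-1], and [(1 - x) (1 + x + 2 x^2) = 1 +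
    x^2 (1 - 2 x)] is at least 1 in this range. *)
Lemma expR_le_quadratic (x : R) : x <= 2^-1 -> expR x <= 1 + x + 2 * x ^+ 2.
Proof.
move=> x2; have := expR_ge1Dx (- x); rewrite expRN => h.
have e0 := expR_gt0 x.
have : expR x * (1 - x) <= 1.
  by rewrite -[leRHS](mulfV (lt0r_neq0 e0)) ler_pM2l.
have x0 : 0 < 1 - x by lra.
rewrite -ler_pdivlMr // => /le_trans; apply; rewrite ler_pdivrMr //.
have : 0 <= x ^+ 2 * (1 - 2 * x) by apply: mulr_ge0; [exact: sqr_ge0|lra].
nra.
Qed.

(** The variable is centred, so the linear terms cancel; the quadratic ones add up to
    [2 c^2 q (1 - q) <= c^2 / 2]. *)
Lemma bernoulli_mgf (q c : R) : 0 <= q <= 1 -> `|c| <= 2^-1 ->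
  q * expR (c * (1 - q)) + (1 - q) * expR (- (c * q)) <= expR (c ^+ 2 / 2).
Proof.
move=> /andP[q0 q1]; rewrite ler_norml => /andP[c1 c2].
have e1 : expR (c * (1 - q)) <= 1 + c * (1 - q) + 2 * (c * (1 - q)) ^+ 2.
  by apply: expR_le_quadratic; nra.
have e2 : expR (- (c * q)) <= 1 - c * q + 2 * (- (c * q)) ^+ 2.
  by apply: expR_le_quadratic; nra.
apply: le_trans (expR_ge1Dx _).
have : q * expR (c * (1 - q)) + (1 - q) * expR (- (c * q)) <=
       1 + 2 * (c ^+ 2 * (q * (1 - q))).
  have := ler_wpM2l q0 e1; have q1' : 0 <= 1 - q by lra.
  have := ler_wpM2l q1' e2; nra.
move=> /le_trans; apply; rewrite lerD2l.
have : q * (1 - q) <= 4^-1 by have := sqr_ge0 (q - 2^-1); nra.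
move=> /(ler_wpM2l (sqr_ge0 c)); nra.
Qed.

(** The exponential moment factorises over the pairs: those avoiding [x] contribute 1, and each of
    the [n - 1] others is bounded by [bernoulli_mgf]. *)
Lemma mgf_incident_edges w x (c : 'I_n -> R) :
  (forall i j, 0 <= w i j <= 1) -> (forall i j, w i j = w j i) ->
  forall t, 0 <= t <= 2^-1 -> (forall y, `|c y| <= 1) ->
  \sum_g edge_pmf w g *
    expR (t * \sum_(y | y != x) c y * ((g x y)%:R - w x y)) <=
  expR (t ^+ 2 / 2 * n%:R).
Proof.
move=> w01 ws t /andP[t0 t1] c1.
pose E y (b : bool) := expR (t * (c y * (b%:R - w x y))).
pose f i j (b : bool) := (if b then w i j else 1 - w i j) *
  (if i == x then E j b else if j == x then E i b else 1).
have -> : \sum_g edge_pmf w g *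
    expR (t * \sum_(y | y != x) c y * ((g x y)%:R - w x y)) =
    \sum_(g : 'M[bool]_n | simple_graph g)
      \prod_(i < n) \prod_(j < n | (i < j)%N) f i j (g i j).
  rewrite [RHS]big_mkcond /=; apply: eq_bigr => g _.
  rewrite /edge_pmf; case: ifP => [/simple_graphP[gs _]|]; last by rewrite mul0r.
  rewrite mulr_sumr expR_sum (prod_incident_pairs x) -big_split /=.
  apply: eq_bigr => i _; rewrite -big_split /=; apply: eq_bigr => j _.
  congr (_ * _); case: eqP => [->//|_]; case: eqP => // jx.
  by rewrite -jx gs /E -jx.
rewrite sum_simple_graphs.
(* Only [n - 1] of the [n] factors are matched with a vertex [y != x]; the spare one is at least
   1. *)
have -> : expR (t ^+ 2 / 2 * n%:R) =
    expR (t ^+ 2 / 2) * \prod_(y | y != x) expR (t ^+ 2 / 2).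
  rewrite prodr_const -[RHS]exprS -expRM_natr; congr (expR (_ * _%:R)).
  by rewrite cardC1 card_ord prednK // (leq_ltn_trans _ (ltn_ord x)).
have E0 y b : 0 <= E y b by exact: expR_ge0.
have step q y : 0 <= q <= 1 -> w x y = q ->
    q * E y true + (1 - q) * E y false <= expR (t ^+ 2 / 2).
  move=> q01 wq; rewrite /E wq sub0r 2!mulrN !mulrA.
  have tc : `|t * c y| <= 2^-1.
    rewrite normrM ger0_norm // (le_trans _ t1) //.
    by rewrite -[leRHS]mulr1 ler_wpM2l.
  apply: le_trans (bernoulli_mgf q01 tc) _; rewrite ler_expR ler_wpM2r //.
  rewrite exprMn -[leRHS]mulr1 ler_wpM2l ?sqr_ge0 //.
  by rewrite -real_normK ?num_real // expr_le1.
have f0 i j : 0 <= f i j true + f i j false.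
  have /andP[? ?] := w01 i j.
  by apply: addr_ge0; apply: mulr_ge0; rewrite ?subr_ge0 //;
    case: ifP => // _; case: ifP.
rewrite -[leLHS]mul1r; apply: ler_pM => //.
- by apply: prodr_ge0 => i _; apply: prodr_ge0 => j _.
- by rewrite -[leLHS]expR0 ler_expR divr_ge0 ?sqr_ge0.
rewrite (prod_incident_pairs x).
apply: ler_prod => i _; rewrite prodr_ge0 //=.
apply: ler_prod => j _; rewrite f0 /= /f.
case: eqP => [->|_]; first exact: step.
case: eqP => [jx|_]; last by rewrite !mulr1 addrC subrK.
by apply: step => //; rewrite ws jx.
Qed.

End RandomGraph.

Lemma big_classes (T : finType) (P : {set {set T}}) (V : Type) (idx : V)
    (op : Monoid.com_law idx) (h : T -> V) :
  finset.partition P [set: T]%SET ->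
  \big[op/idx]_y h y = \big[op/idx]_(C in P) \big[op/idx]_(y in C) h y.
Proof.
move=> Ppart; rewrite -(set_partition_big _ Ppart).
by apply: eq_bigl => y; rewrite finset.in_setT.
Qed.

(** * The seminorm of class sums *)

Section PartitionNorm.
Context {R : realType} {n : nat}.
Implicit Types (h : 'I_n -> R) (P : {set {set 'I_n}}).

(** On a difference of two adjacency rows this is [n] times the [L1_dist] of the two vertices. *)
Definition partition_norm P h : R := \sum_(C in P) `|\sum_(y in C) h y|.

Lemma partition_norm_le_sum P h :
  finset.partition P [set: 'I_n]%SET -> partition_norm P h <= \sum_y `|h y|.
Proof.
move=> Ppart; rewrite (big_classes _ _ Ppart).
by apply: ler_sum => C _; exact: ler_norm_sum.
Qed.

Lemma partition_normD P h1 h2 :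
  partition_norm P (h1 \+ h2) <= partition_norm P h1 + partition_norm P h2.
Proof.
rewrite /partition_norm -big_split /=; apply: ler_sum => C _.
by rewrite big_split /= ler_normD.
Qed.

Lemma partition_normN P h : partition_norm P (\- h) = partition_norm P h.
Proof. by apply: eq_bigr => C _; rewrite sumrN normrN. Qed.

Lemma partition_normB P h1 h2 :
  partition_norm P (h1 \- h2) <= partition_norm P h1 + partition_norm P h2.
Proof. by rewrite -(partition_normN P h2) partition_normD. Qed.

(** With [Q] the classes of non-negative sum, the seminorm becomes one of [2 ^ #|P|] linear
    statistics, to which [mgf_incident_edges] applies. *)
Lemma partition_norm_signs P h : finset.partition P [set: 'I_n]%SET ->
  exists2 Q : {set {set 'I_n}}, Q \subset P &
    partition_norm P h = \sum_y (-1) ^+ (finset.pblock P y \notin Q) * h y.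
Proof.
move=> Ppart; pose Q := [set C in P | 0 <= \sum_(y in C) h y]%SET; exists Q.
  by apply/fintype.subsetP => C; rewrite inE => /andP[].
rewrite (big_classes _ _ Ppart).
apply: eq_bigr => C CP; have /and3P[_ triv _] := Ppart.
rewrite [RHS](eq_bigr (fun y => (-1) ^+ (C \notin Q) * h y)); last first.
  by move=> y yC; rewrite (def_pblock triv CP yC).
rewrite -mulr_sumr inE CP /=; case: (leP 0 (\sum_(y in C) h y)) => s0 /=.
  by rewrite mul1r ger0_norm.
by rewrite mulN1r ltr0_norm.
Qed.

End PartitionNorm.

(** * Chernoff bound and the number of vertices of large deviation *)

Section Concentration.
Context {R : realType} {n : nat}.
Variables (w : 'I_n -> 'I_n -> R) (P : {set {set 'I_n}}).
Hypothesis w01 : forall i j, 0 <= w i j <= 1.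
Hypothesis w_sym : forall i j, w i j = w j i.
Hypothesis Ppart : finset.partition P [set: 'I_n]%SET.

(** The diagonal is set to 0 because a simple graph has no loops: [g x x] is not a random variable
    of mean [w x x]. *)
Definition deviation (g : 'M[bool]_n) (x y : 'I_n) : R :=
  if y == x then 0 else (g x y)%:R - w x y.

(** Chernoff bound with parameter [t = eps], summed over the sign patterns [Q]; the exponent is
    [eps^2 n / 2 - eps^2 n]. The bound [eps <= 1/2] is the range of the moment estimate. *)
Lemma deviation_tail (x : 'I_n) (eps : R) : 0 <= eps <= 2^-1 ->
  \sum_(g : 'M[bool]_n | eps * n%:R <= partition_norm P (deviation g x))
    edge_pmf w g <= 2 ^+ #|P| * expR (- (eps ^+ 2 * n%:R / 2)).
Proof.
move=> eps01; have /andP[eps0 _] := eps01.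
pose c (Q : {set {set 'I_n}}) y : R := (-1) ^+ (finset.pblock P y \notin Q).
pose X Q (g : 'M[bool]_n) := \sum_(y | y != x) c Q y * ((g x y)%:R - w x y).
apply: (@le_trans _ _ (\sum_(Q in powerset P)
   \sum_g edge_pmf w g * expR (eps * X Q g) * expR (- (eps ^+ 2 * n%:R)))).
  rewrite exchange_big /= big_mkcond /=; apply: ler_sum => g _.
  have g0 := edge_pmf_ge0 g w01.
  case: ifP => [bad|_]; last first.
    by apply: sumr_ge0 => Q _; rewrite !mulr_ge0 ?expR_ge0.
  have [Q QP eN] := partition_norm_signs (deviation g x) Ppart.
  have XE : X Q g = partition_norm P (deviation g x).
    rewrite eN (bigD1 x) //= /deviation eqxx mulr0 add0r.
    by apply: eq_bigr => y /negbTE ->.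
  rewrite (bigD1 Q) ?powersetE //= -[leLHS]addr0; apply: lerD.
    rewrite -[leLHS]mulr1 -mulrA ler_wpM2l // -expRD -[leLHS]expR0 ler_expR.
    by rewrite subr_ge0 expr2 -mulrA ler_wpM2l // XE.
  by apply: sumr_ge0 => Q' _; rewrite !mulr_ge0 ?expR_ge0.
have -> : 2 ^+ #|P| * expR (- (eps ^+ 2 * n%:R / 2)) =
    \sum_(Q in powerset P) expR (- (eps ^+ 2 * n%:R / 2)) :> R.
  by rewrite sumr_const card_powerset -natrX mulr_natl.
apply: ler_sum => Q _; rewrite -mulr_suml.
have -> : - (eps ^+ 2 * n%:R / 2) =
   eps ^+ 2 / 2 * n%:R + - (eps ^+ 2 * n%:R) by field.
rewrite expRD ler_wpM2r ?expR_ge0 //.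
apply: mgf_incident_edges => // y.
by rewrite normrX normrN normr1 expr1n.
Qed.

Definition bad_vertices (eps : R) (g : 'M[bool]_n) : {set 'I_n} :=
  [set x | eps * n%:R <= partition_norm P (deviation g x)]%SET.

(** The first error term is a union bound over [s], the second is Markov's inequality for the number
    of bad vertices. *)
Lemma good_graph_probability (s : {set 'I_n}) (eps m beta : R) :
  0 <= eps <= 2^-1 -> 0 < m ->
  beta = 2 ^+ #|P| * expR (- (eps ^+ 2 * n%:R / 2)) ->
  1 - (#|s|%:R * beta + n%:R * beta / m) <=
  \sum_(g : 'M[bool]_n | [disjoint s & bad_vertices eps g] &&
                         (#|bad_vertices eps g|%:R <= m))
    edge_pmf w g.
Proof.
move=> eps01 m0 betaE; set bad := bad_vertices eps.
pose good g := [disjoint s & bad g] && (#|bad g|%:R <= m).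
have := sum_edge_pmf w; rewrite (bigID good) /= -/good => tot.
rewrite lerBlDr -[X in X <= _]tot lerD2l.
(* Give each bad vertex the weight [(x \in s) + 1 / m]. In a failing graph the total is at least 1:
   either one bad vertex lies in [s], or more than [m] of them carry [1 / m] each. *)
apply: (@le_trans _ _ (\sum_g \sum_x (if x \in bad g then
    ((x \in s)%:R + m^-1) * edge_pmf w g else 0))).
  rewrite big_mkcond /=; apply: ler_sum => g _.
  have g0 := edge_pmf_ge0 g w01.
  rewrite -big_mkcond /= -mulr_suml.
  have s0 : 0 <= \sum_(x in bad g) ((x \in s)%:R + m^-1).
    by apply: sumr_ge0 => x _; rewrite addr_ge0 ?invr_ge0 ?(ltW m0).
  case: ifP => [|_]; last exact: mulr_ge0.
  rewrite negb_and => ng; rewrite -[leLHS]mul1r ler_wpM2r //.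
  rewrite big_split /= sumr_const -[X in _ + X]mulr_natl.
  have s1 : 0 <= \sum_(x in bad g) (x \in s)%:R :> R by apply: sumr_ge0.
  case/orP: ng => [|].
    rewrite -setI_eq0 => /set0Pn[x]; rewrite !inE => /andP[xs xb].
    rewrite -[leLHS]addr0 lerD //; last by rewrite divr_ge0 ?(ltW m0).
    rewrite (bigD1 x) /= ?inE // xs lerDl; exact: sumr_ge0.
  rewrite -ltNge => ltm; apply: ler_wpDl => //.
  by rewrite ler_pdivlMr // mul1r ltW.
rewrite exchange_big /=.
have -> : #|s|%:R * beta + n%:R * beta / m = \sum_(x < n) ((x \in s)%:R + m^-1) * beta.
  rewrite -mulr_suml big_split /= mulrDl sumr_const card_ord -(mulr_natl m^-1).
  congr (_ * _ + _); last by rewrite mulrAC.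
  by rewrite -sum1_card natr_sum big_mkcond; apply: eq_bigr => i _; case: (i \in s).
apply: ler_sum => x _; rewrite -big_mkcond /= -mulr_sumr ler_wpM2l //.
  by rewrite addr_ge0 ?invr_ge0 ?(ltW m0).
by under eq_bigl do rewrite inE; rewrite betaE; exact: deviation_tail.
Qed.

End Concentration.

(** * Deterministic analysis of one step *)

Section Classification.
Context {n : nat}.
Implicit Types (b C : {set 'I_n}) (P : {set {set 'I_n}}) (x y : 'I_n).

(** Combinatorial form of [num_correct]: the block of [A] is [b] and that of [B] is its
    complement. *)
Definition correct b P : nat :=
  #|[set x | x \in (if #|~: b :&: finset.pblock P x| <= #|b :&: finset.pblock P x|
                    then b :&: finset.pblock P x
                    else ~: b :&: finset.pblock P x)%N]%SET|.

Lemma num_correct_blocks (R : realType) (A B : set R) (u : 'I_n -> R) P b :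
  block u A = b -> block u B = (~: b)%SET -> num_correct A B u P = correct b P.
Proof. by move=> <- E; rewrite /num_correct /majority E. Qed.

Lemma correct_sum b P : finset.partition P [set: 'I_n]%SET ->
  correct b P = (\sum_(C in P) maxn #|b :&: C| #|~: b :&: C|)%N.
Proof.
move=> Ppart; have /and3P[_ triv _] := Ppart.
rewrite /correct -sum1_card big_mkcond /= (big_classes _ _ Ppart).
apply: eq_bigr => C CP; set M := (X in _ = X).
transitivity #|if (#|~: b :&: C| <= #|b :&: C|)%N then b :&: C else ~: b :&: C|.
  rewrite -sum1_card [RHS]big_mkcond [LHS]big_mkcond /=; apply: eq_bigr => x _.
  case: (boolP (x \in C)) => xC; first by rewrite inE (def_pblock triv CP xC).
  by case: (leqP #|_|) => _; rewrite !inE (negbTE xC) andbF.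
by rewrite /M /maxn ltnNge; case: ifP.
Qed.

(** The vertices of a bin share the value of [f], so those agreeing with it lie in a single block
    and number at most the majority of the bin. *)
Lemma card_same_block_le_correct b (f : {ffun 'I_n -> 'I_n}) :
  (#|[set x | (x \in b) == (f x \in b)]%SET| <= correct b (bins f))%N.
Proof.
have Ppart : finset.partition (bins f) [set: 'I_n]%SET by exact: preim_partitionP.
have /and3P[_ triv nz] := Ppart.
rewrite correct_sum // -sum1_card big_mkcond /= (big_classes _ _ Ppart).
apply: leq_sum => C CP.
have [x0 x0C] : exists x, x \in C.
  by apply/finset.set0Pn; apply: contraNneq nz => <-.
have fC x : x \in C -> f x = f x0.
  rewrite -{1}(def_pblock triv CP x0C) pblock_equivalence_partition ?inE //.
    by move=> /eqP.
  by split=> // /eqP ->.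
rewrite -big_mkcondr /= sum1dep_card.
case: (boolP (f x0 \in b)) => fb; [apply: leq_trans (leq_maxl _ _)|
  apply: leq_trans (leq_maxr _ _)]; apply/subset_leq_card/fintype.subsetP => x.
  by rewrite !inE => /andP[xC]; rewrite (fC _ xC) fb eqb_id xC => ->.
by rewrite !inE => /andP[xC]; rewrite (fC _ xC) (negbTE fb) xC andbT => /eqP ->.
Qed.

(** Sum [|u - v| = 2 max(u, v) - (u + v)] over the classes. *)
Lemma sum_imbalance (R : realType) b P : finset.partition P [set: 'I_n]%SET ->
  \sum_(C in P) `|#|b :&: C|%:R - #|~: b :&: C|%:R| =
  2 * (correct b P)%:R - n%:R :> R.
Proof.
move=> Ppart; rewrite correct_sum //.
have nE : n%:R = \sum_(C in P) (#|b :&: C|%:R + #|~: b :&: C|%:R) :> R.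
  rewrite -[in LHS](card_ord n) -cardsT (card_partition Ppart) natr_sum.
  apply: eq_bigr => C _; rewrite -natrD; congr _%:R.
  by rewrite -(cardsID b C) finset.setDE ![(C :&: _)%SET]finset.setIC.
rewrite {}nE natr_sum mulr_sumr -sumrB; apply: eq_bigr => C _.
rewrite natr_max; set u := _%:R; set v := _%:R.
case: (leP u v) => uv; [rewrite ler0_norm|rewrite gtr0_norm]; lra.
Qed.

Lemma card_partition_le P : finset.partition P [set: 'I_n]%SET -> (#|P| <= n)%N.
Proof.
move=> Ppart; have /and3P[_ _ P0] := Ppart.
rewrite -[leqRHS]card_ord -cardsT (card_partition Ppart) -sum1_card.
by apply: leq_sum => X XP; rewrite card_gt0; apply: contraNneq P0 => <-.
Qed.

End Classification.

(** * Assignment of vertices to the nearest centroids *)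

Section CentroidStep.
Context {R : realType} {n : nat}.
Variables (q0 q1 eps : R) (b : {set 'I_n}) (P : {set {set 'I_n}}) (g : 'M[bool]_n).
Hypothesis q0_01 : 0 <= q0 <= 1.
Hypothesis q1q0 : q1 <= q0.
Hypothesis Ppart : finset.partition P [set: 'I_n]%SET.
Hypothesis g_simple : simple_graph g.

Definition block_density (i j : 'I_n) : R :=
  if (i \in b) == (j \in b) then q0 else q1.

Lemma block_density_sym i j : block_density i j = block_density j i.
Proof. by rewrite /block_density eq_sym. Qed.

(** The weight [#|C| / n] cancels the normalisation by the class size. *)
Lemma weighted_densityE x C :
  weighted_density R g x C = (\sum_(y in C) (g x y)%:R) / n%:R.
Proof.
rewrite /weighted_density /edge_density big_set1 cards1 mul1r.
(* For an empty class the density is a division by zero, whose value 0 agrees with the empty sum. *)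
have [->|C0] := eqVneq C finset.set0; first by rewrite cards0 big_set0 !mul0r.
have : #|C|%:R != 0 :> R by rewrite pnatr_eq0 cards_eq0.
have [->|n0] := eqVneq (n%:R : R) 0; first by rewrite invr0 !(mulr0, mul0r).
by move=> C0'; field; rewrite C0' n0.
Qed.

Lemma L1_distE x y :
  L1_dist R P g x y =
  partition_norm P (fun z => (g x z)%:R - (g y z)%:R) / n%:R.
Proof.
rewrite /L1_dist /partition_norm mulr_suml; apply: eq_bigr => C _.
rewrite !weighted_densityE -mulrBl normrM sumrB.
by rewrite (@ger0_norm _ (n%:R)^-1) // invr_ge0.
Qed.

Let good x := x \notin bad_vertices block_density P eps g.

(* Restoring the diagonal term of the expected density costs at most q0 <= 1. *)
Lemma good_deviation x : good x ->
  partition_norm P (fun y => (g x y)%:R - block_density x y) < eps * n%:R + 1.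
Proof.
rewrite /good inE -ltNge => gx.
pose diag y : R := if y == x then q0 else 0.
have -> : (fun y => (g x y)%:R - block_density x y) =
          deviation block_density g x \- diag.
  apply/funext => y /=; rewrite /deviation /diag; case: eqP => [->|_].
    by have [_ ->] := simple_graphP g_simple; rewrite /block_density eqxx.
  by rewrite subr0.
apply: le_lt_trans (partition_normB _ _ _) _; apply: ltr_leD => //.
apply: le_trans (partition_norm_le_sum _ Ppart) _.
have /andP[q00 q01] := q0_01.
rewrite (bigD1 x) //= big1 ?addr0 => [|y /negbTE yx]; last first.
  by rewrite /diag yx normr0.
by rewrite /diag eqxx ger0_norm.
Qed.

(** The mean rows differ by [q0 - q1] at each vertex, with a sign depending on its block. A class
    thus contributes [q0 - q1] times its imbalance, and [sum_imbalance] applies. *)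
Lemma block_density_separation x y : (x \in b) != (y \in b) ->
  partition_norm P (fun z => block_density x z - block_density y z) =
  (q0 - q1) * (2 * (correct b P)%:R - n%:R).
Proof.
move=> xy; rewrite -(sum_imbalance R b Ppart) mulr_sumr; apply: eq_bigr => C _.
have q01 : 0 <= q0 - q1 by rewrite subr_ge0.
rewrite -[X in X * _](ger0_norm q01) -normrM.
have -> : (q0 - q1) * (#|b :&: C|%:R - #|~: b :&: C|%:R) =
    \sum_(z in C) (if z \in b then q0 - q1 else q1 - q0).
  rewrite [RHS](bigID (mem b)) /= [X in _ = X + _](eq_bigr (fun=> q0 - q1)); last first.
    by move=> z /andP[_ ->].
  rewrite [X in _ = _ + X](eq_bigr (fun=> q1 - q0)); last by move=> z /andP[_ /negbTE ->].
  rewrite !sumr_const -(mulr_natr (q0 - q1)) -(mulr_natr (q1 - q0)).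
  have -> : #|[pred z | (z \in C) && (z \in b)]| = #|b :&: C|.
    by apply: eq_card => z; rewrite !inE andbC.
  have -> : #|[pred z | (z \in C) && (z \notin b)]| = #|~: b :&: C|.
    by apply: eq_card => z; rewrite !inE andbC.
  ring.
have [xb|xb] := boolP (x \in b).
  congr `|_|; apply: eq_bigr => z _; rewrite /block_density xb.
  by move: xy; rewrite xb; case: (y \in b) => // _; case: (z \in b).
rewrite -normrN -sumrN; congr `|_|; apply: eq_bigr => z _.
rewrite /block_density (negbTE xb).
by move: xy; rewrite (negbTE xb); case: (y \in b) => // _;
  case: (z \in b); rewrite //= opprB.
Qed.

Hypothesis separation :
  4 * (eps * n%:R) + 4 <= (q0 - q1) * (2 * (correct b P)%:R - n%:R).

(** The mean rows of [x] and [c] coincide, so their distance is at most two deviations, while that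
    of [x] and [c'] is at least the separation of the means minus two deviations. Each deviation is
    below [eps n + 1], whence the constants 4 in [separation]. *)
Lemma same_block_closer x c c' : good x -> good c -> good c' ->
  (x \in b) == (c \in b) -> (x \in b) != (c' \in b) ->
  L1_dist R P g x c < L1_dist R P g x c'.
Proof.
move=> gx gc gc' xc xc'.
have n0 : 0 < n%:R :> R by rewrite ltr0n (leq_ltn_trans _ (ltn_ord x)).
rewrite !L1_distE ltr_pM2r ?invr_gt0 //.
pose h z y : R := (g z y)%:R - block_density z y.
have hx : partition_norm P (h x) < eps * n%:R + 1 := good_deviation gx.
have hc : partition_norm P (h c) < eps * n%:R + 1 := good_deviation gc.
have hc' : partition_norm P (h c') < eps * n%:R + 1 := good_deviation gc'.
have -> : (fun z => (g x z)%:R - (g c z)%:R) = h x \- h c :> ('I_n -> R).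
  apply/funext => z /=; rewrite /h.
  have -> : block_density x z = block_density c z by rewrite /block_density (eqP xc).
  by rewrite opprB addrA subrK.
apply: le_lt_trans (partition_normB _ _ _) _.
have sep := separation; rewrite -(block_density_separation xc') in sep.
pose d z : R := (g x z)%:R - (g c' z)%:R.
have dE : (fun z => block_density x z - block_density c' z) = d \- (h x \- h c').
  by apply/funext => z /=; rewrite /h /d; ring.
rewrite {}dE in sep; rewrite -/d.
have tri := le_trans (partition_normB P d (h x \- h c'))
                     (lerD (lexx _) (partition_normB P (h x) (h c'))).
have {sep tri} := le_trans sep tri.
move: hx hc hc'; move: (partition_norm P (h x)) (partition_norm P (h c)).
move: (partition_norm P (h c')) (partition_norm P d) (eps * n%:R).
move=> *; lra.
Qed.

Lemma nearest_same_block (S : {set 'I_n}) x c c' :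
  (forall s, s \in S -> good s) -> good x -> c \in S ->
  (x \in b) == (c \in b) -> c' \in nearest R P g S x -> (x \in b) == (c' \in b).
Proof.
move=> gS gx cS xc; rewrite inE => /andP[c'S /forall_inP/(_ c cS)].
by rewrite leNgt; apply: contraNT => /(same_block_closer gx (gS _ cS) (gS _ c'S) xc).
Qed.

(** Both blocks contain a centroid, so every good vertex has one of its own block to join; only bad
    vertices can be lost. *)
Lemma correct_after_step (S : {set 'I_n}) (f : {ffun 'I_n -> 'I_n}) :
  assignment_pmf R P g S f != 0 ->
  [disjoint S & bad_vertices block_density P eps g]%B ->
  ~~ (S \subset b) -> ~~ [disjoint S & b] ->
  (n <= correct b (bins f) + #|bad_vertices block_density P eps g|)%N.
Proof.
move=> f0 Sgood nSb Sb; set bad := bad_vertices _ _ _ _.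
have gS s : s \in S -> good s by move=> sS; rewrite /good (disjointFr Sgood sS).
apply: leq_trans (leq_add (card_same_block_le_correct b f) (leqnn _)).
rewrite -[X in (X <= _)%N](card_ord n) -cardsT.
apply: leq_trans (leq_card_setU _ _); apply/subset_leq_card/fintype.subsetP => x _.
rewrite inE orbC; case: (boolP (x \in bad)) => //= gx; rewrite inE.
(* A non-zero product has no zero factor: [f x] is [x] itself for a centroid, and a nearest centroid
   otherwise. *)
move: f0; rewrite prodf_seq_neq0 => /allP/(_ x); rewrite mem_index_enum => /(_ isT) /=.
case: ifP => [xS|_]; first by case: (f x =P x) => [->//|_]; rewrite eqxx.
case: ifP => [fx _|_]; last by rewrite eqxx.
have [c cS xc] : exists2 c, c \in S & (x \in b) == (c \in b).
  case: (boolP (x \in b)) => xb.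
    have /exists_inP[c cS cb] : [exists c in S, c \in b].
      by apply: contraNT Sb => /exists_inPn h; rewrite disjoint_subset;
        apply/fintype.subsetP => z /h.
    by exists c; rewrite // cb.
  by have [c cS /negbTE cb] := fintype.subsetPn nSb; exists c; rewrite // cb.
exact: nearest_same_block xc fx.
Qed.

End CentroidStep.

(** * Finite laws and the decomposition into cells *)

Section FiniteLaws.
Context {R : realType} {n : nat}.

Lemma assignment_pmf_ge0 P g (S : {set 'I_n}) f : 0 <= assignment_pmf R P g S f.
Proof.
apply: prodr_ge0 => x _; case: ifP => // _; case: ifP => // _.
Qed.

(** The law is a product over the vertices, so it suffices that each factor has mass 1; for this
    some centroid must attain the minimal distance, hence [S] non-empty. *)
Lemma sum_assignment_pmf P g (S : {set 'I_n}) :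
  S != finset.set0 -> \sum_f assignment_pmf R P g S f = 1.
Proof.
move=> /finset.set0Pn[s0 s0S].
rewrite /assignment_pmf -(bigA_distr_bigA (fun x y => if x \in S then (y == x)%:R
  else if y \in nearest R P g S x then #|nearest R P g S x|%:R^-1 else 0)) /=.
rewrite big1 // => x _; case: (boolP (x \in S)) => xS.
  by rewrite (bigD1 x) //= eqxx big1 ?addr0 // => y /negbTE ->.
rewrite -big_mkcond sumr_const -(mulr_natr #|nearest R P g S x|%:R^-1) mulVf //.
rewrite pnatr_eq0 -lt0n card_gt0.
case: (@arg_minP _ R _ s0 (fun i => i \in S) (L1_dist R P g x) s0S) => c cS cmin.
by apply/finset.set0Pn; exists c; rewrite inE; apply/andP; split=> //; apply/forall_inP.
Qed.

Lemma centroids_pmf_ge0 k (S : {set 'I_n}) : 0 <= centroids_pmf R k S.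
Proof. by rewrite /centroids_pmf; case: ifP => // _; rewrite invr_ge0. Qed.

Lemma sum_centroids_pmf k : (k <= n)%N ->
  \sum_(S : {set 'I_n}) centroids_pmf R k S = 1.
Proof.
move=> kn; rewrite /centroids_pmf -big_mkcond sumr_const /=.
have -> : #|[pred S : {set 'I_n} | #|S| == k]| = 'C(n, k).
  by rewrite -[in RHS](card_ord n) -card_draws; apply: eq_card => S; rewrite !inE.
by rewrite -(mulr_natr _^-1) mulVf // pnatr_eq0 -lt0n bin_gt0.
Qed.

(** The probability that [b] is exactly the set of vertices with latent position in [A]. *)
Definition block_weight (p : R) (b : {set 'I_n}) : R :=
  \prod_(i < n) (if i \in b then p else 1 - p).

(** The excluded events, all of [s] in [b] and none of it, are incompatible since [s] is non-empty,
    and have weights [p ^ #|s|] and [(1 - p) ^ #|s|]. *)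
Lemma sum_block_weight_split p (s : {set 'I_n}) : s != finset.set0 ->
  \sum_(b : {set 'I_n} | ~~ (s \subset b) && ~~ [disjoint s & b]) block_weight p b =
  1 - p ^+ #|s| - (1 - p) ^+ #|s|.
Proof.
move=> s0.
have distr (u v : 'I_n -> R) : \prod_i (u i + v i) =
    \sum_(b : {set 'I_n}) \prod_i (if i \in b then u i else v i).
  by rewrite bigA_distr; apply: eq_bigl.
have all_b : \sum_b block_weight p b = 1.
  rewrite -(distr (fun=> p) (fun=> 1 - p)) big1 // => i _.
  by rewrite addrC subrK.
have sub_b : \sum_(b : {set 'I_n} | s \subset b) block_weight p b = p ^+ #|s|.
  rewrite -prodr_const [RHS]big_mkcond /=.
  (* Deleting the summand [1 - p] at the indices of [s] leaves exactly the sets [b] containing [s]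
     in the expansion. *)
  transitivity (\prod_(i < n) (p + (if i \in s then 0 else 1 - p))).
    rewrite distr big_mkcond; apply: eq_bigr => b _.
    case: ifPn => [/fintype.subsetP sb|/fintype.subsetPn[i si nb]].
      apply: eq_bigr => i _; case: ifP => // /negbT nb.
      by case: ifP => // /sb; rewrite (negbTE nb).
    by rewrite (bigD1 i) //= (negbTE nb) si mul0r.
  by apply: eq_bigr => i _; case: ifP; rewrite ?addr0 // addrC subrK.
have dis_b : \sum_(b : {set 'I_n} | [disjoint s & b]) block_weight p b = (1 - p) ^+ #|s|.
  rewrite -prodr_const [RHS]big_mkcond /=.
  transitivity (\prod_(i < n) ((if i \in s then 0 else p) + (1 - p))).
    rewrite distr big_mkcond; apply: eq_bigr => b _.
    case: ifPn => [sb|].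
      apply: eq_bigr => i _; case: ifP => // ib.
      by case: ifP => // is_; rewrite (disjointFr sb is_) in ib.
    rewrite -setI_eq0 => /finset.set0Pn[i]; rewrite inE => /andP[si ib].
    by rewrite (bigD1 i) //= ib si mul0r.
  by apply: eq_bigr => i _; case: ifP; rewrite ?add0r // addrC subrK.
have dis_notsub : \sum_(b : {set 'I_n} | ~~ (s \subset b) && [disjoint s & b])
    block_weight p b = (1 - p) ^+ #|s|.
  rewrite -dis_b; apply: eq_bigl => b; apply: andb_idl => sb.
  by apply: contra s0 => /finset.setIidPl <-; rewrite setI_eq0.
move: all_b; rewrite (bigID (fun b : {set 'I_n} => s \subset b)) /= sub_b.
rewrite (bigID (fun b : {set 'I_n} => [disjoint s & b]%B)) /= dis_notsub => tot.
by apply/eqP; rewrite -addrA -opprD eq_sym subr_eq addrC -addrA tot.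
Qed.

End FiniteLaws.

(** * Additivity over finitely many disjoint events *)

Section Measure.
Context {R : realType} {d : measure_display} {T : measurableType d}.
Variable Pr : probability T R.

Lemma measure_finite_bigcup (I : finType) (P : pred I) (E : I -> set T) :
  (forall i, measurable (E i)) -> trivIset [set: I] E ->
  Pr (\bigcup_(i in [set` P]) E i) = (\sum_(i | P i) Pr (E i))%E.
Proof.
move=> mE tE; have tP : trivIset [set` P] E by apply: sub_trivIset tE => i _.
rewrite (measure_fin_bigcup Pr finite_finset tP (fun i _ => mE i)).
rewrite (@bigfs _ _ _ _ (index_enum I)) ?index_enum_uniq // => i _.
by rewrite mem_index_enum.
Qed.

Lemma sum_cells_le (I : finType) (P : pred I) (E : I -> set T) (X : set T) :
  measurable X -> (forall i, measurable (E i)) -> trivIset [set: I] E ->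
  (forall i, P i -> E i `<=` X) -> (\sum_(i | P i) Pr (E i) <= Pr X)%E.
Proof.
move=> mX mE tE EX; rewrite -measure_finite_bigcup //; apply: le_measure.
- by rewrite inE; apply: fin_bigcup_measurable => //; exact: finite_finset.
- by rewrite inE.
- by apply: bigcup_sub => i; exact: EX.
Qed.

Lemma sum_fibers (F : finType) (X : T -> F) (E : set T) :
  finite_rv X -> measurable E ->
  (\sum_a Pr (E `&` X @^-1` [set a]) = Pr E)%E.
Proof.
move=> mX mE; rewrite -measure_finite_bigcup.
- congr (Pr _); apply/seteqP; split=> [w [a _ []] //|w Ew].
  by exists (X w).
- by move=> a; apply: measurableI => //; exact: mX.
- by move=> a a' _ _ [w [[_ /= <-] [_ /= <-]]].
Qed.

End Measure.

(** * Numerical consequences of (i) and (ii) *)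

Section Numerics.
Context {R : realType}.

(* With [s] the square root, [(1 - s) * (1 + s) = 4 k (1 - tau)] and [s <= 1]
   give [1 - s >= 2 k (1 - tau)]. *)
Lemma density_gap_lower_bound (k n tau eps gap : R) :
  2 <= k -> 0 < n -> 1 - (4 * k)^-1 < tau -> tau < 1 ->
  (3 - Num.sqrt (1 - 4 * k * (1 - tau))) / tau - 2 + 4 * eps
    + (1 - Num.sqrt (1 - 4 * k * (1 - tau))) / (n * tau * (1 - tau)) <= gap ->
  2 * (1 - tau) + 4 * eps + 4 / n <= gap.
Proof.
move=> k2 n0 tau_gt tau1; apply: le_trans; set s := Num.sqrt _.
pose delta := 1 - tau.
have delta0 : 0 < delta by rewrite subr_gt0.
have k0 : 0 < k by lra.
have dk : 4 * k * delta < 1.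
  rewrite -ltr_pdivlMl ?mulr_gt0 // mulr1 /delta; lra.
have tau0 : 0 < tau.
  have : (4 * k)^-1 <= 1 by rewrite invf_le1 ?mulr_gt0 //; lra.
  lra.
have s2 : s ^+ 2 = 1 - 4 * k * delta by rewrite sqr_sqrtr // subr_ge0 ltW.
have s0 : 0 <= s by exact: sqrtr_ge0.
have kd0 : 0 < k * delta by exact: mulr_gt0.
have s1 : 2 * k * delta <= 1 - s by nra.
have i1 : 1 + delta <= tau^-1.
  rewrite -[leRHS]mul1r ler_pdivlMr // /delta.
  have := sqr_ge0 (1 - tau); lra.
have -> : 2 * (1 - tau) + 4 * eps + 4 / n = 2 * delta + 4 * eps + 4 / n by [].
apply: lerD; first rewrite lerD2r.
  have : (2 + 2 * k * delta) * (1 + delta) <= (3 - s) / tau.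
    apply: ler_pM => //; nra.
  nra.
(* The last term of (i) is at least [2 k / (n tau)], hence at least [4 / n]; this pays for the four
   diagonal corrections. *)
rewrite -/delta -!mulrA ler_pdivrMr //.
have -> : (1 - s) * (n * (tau * delta))^-1 * n = (1 - s) / delta * tau^-1.
  by field; rewrite !lt0r_neq0.
have : 2 * k <= (1 - s) / delta by rewrite ler_pdivlMr.
nra.
Qed.

(** At most [(1 - tau) n] misclassified vertices lower the right-hand side by at most
    [2 (1 - tau) n gap], and [gap <= 1] lets the term [2 (1 - tau)] absorb this. *)
Lemma separation_bound (n tau eps gap cor : R) :
  0 < n -> tau < 1 -> 0 <= eps -> gap <= 1 -> tau * n <= cor ->
  2 * (1 - tau) + 4 * eps + 4 / n <= gap ->
  4 * (eps * n) + 4 <= gap * (2 * cor - n).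
Proof.
move=> n0 tau1 eps0 gap1 cor_ge gap_ge.
have n1 : 0 < 4 / n by rewrite divr_gt0.
have gap0 : 0 <= gap by lra.
have : 2 * (1 - tau) * n + 4 * (eps * n) + 4 <= gap * n.
  have := ler_wpM2r (ltW n0) gap_ge; rewrite !mulrDl divfK ?lt0r_neq0 //; lra.
have : gap * ((2 * tau - 1) * n) <= gap * (2 * cor - n) by rewrite ler_wpM2l //; lra.
have : gap * ((1 - tau) * n) <= (1 - tau) * n.
  by rewrite ler_piMl // mulr_ge0 ?subr_ge0 ?ltW.
lra.
Qed.

(** Condition (ii) says that [a] is below [y = (1 - z^(1/k)) / 2] with [z = tau' + xi]. Since
    [z <= z^(1/k)], it follows that [2 y <= 1 - z < 1 - tau']. *)
Lemma failure_rate_bound (k : nat) (n a eps xi tau' : R) :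
  (2 <= k)%N -> a = expR (- (eps ^+ 2 * n / (12 * k%:R))) ->
  0 < xi -> 0 < tau' -> tau' + xi < 1 ->
  - (12 * k%:R) * ln ((1 - (tau' + xi) `^ k%:R^-1) / 2) < eps ^+ 2 * n ->
  2 * a < 1 - tau'.
Proof.
move=> k2 aE xi0 tau0 z1; set z := tau' + xi in z1 *.
have k0 : 0 < k%:R :> R by rewrite ltr0n; lia.
have z0 : 0 < z by exact: addr_gt0.
set y := (1 - _) / 2 => hy.
(* This makes [y] positive, so that its logarithm can be exponentiated back. *)
have zk1 : z `^ k%:R^-1 < 1.
  rewrite /powR gt_eqF // -[ltRHS]expR0 ltr_expR pmulr_rlt0 ?invr_gt0 //.
  by apply: ln_lt0; rewrite z0.
have y0 : 0 < y by rewrite /y divr_gt0 ?subr_gt0.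
have zk : z <= z `^ k%:R^-1.
  apply: ger1_powR; first by rewrite z0 ltW.
  by rewrite invf_le1 // ler1n; lia.
have ay : a < y.
  rewrite aE -[ltRHS]lnK ?posrE // ltr_expR ltrNl ltr_pdivlMr ?mulr_gt0 //.
  by rewrite mulrC mulrN -mulNr.
have : 2 * y <= 1 - z by rewrite /y; lra.
rewrite /z; lra.
Qed.

(** Each of the two terms is at most [a], because [beta <= 2 a^2]: the first by [k a <= 1/8], the
    second by [2 a < 1 - tau']. *)
Lemma failure_bound (k : nat) (n a eps beta tau' : R) :
  (2 <= k)%N -> 0 < n -> a = expR (- (eps ^+ 2 * n / (12 * k%:R))) ->
  beta = 2 ^+ k * expR (- (eps ^+ 2 * n / 2)) ->
  2 * a < 1 - tau' -> 1 - (4 * k%:R)^-1 < tau' ->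
  k%:R * beta + n * beta / ((1 - tau') * n) <= 2 * a.
Proof.
move=> k2 n0 aE betaE a1 tau_gt.
have k0 : 0 < k%:R :> R by rewrite ltr0n; lia.
have kge2 : 2 <= k%:R :> R by rewrite ler_nat.
have a0 : 0 < a by rewrite aE expR_gt0.
(* Both assumptions combine to [2 a < 1 - tau' < 1 / (4 k)]. *)
have ak : k%:R * a <= 8^-1.
  have : a <= (8 * k%:R)^-1.
    have -> : (8 * k%:R)^-1 = (4 * k%:R)^-1 / 2 :> R by field; rewrite lt0r_neq0.
    lra.
  by rewrite -[X in _ <= X -> _]mul1r ler_pdivlMr ?mulr_gt0 //; lra.
have a8 : a <= 16^-1 by nra.
have betaE' : beta = (2 * a ^+ 6) ^+ k.
  rewrite betaE exprMn -exprM aE -expRM_natr natrM; congr (_ * expR _).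
  by field; rewrite lt0r_neq0.
have c1 : 2 * a ^+ 6 <= 1.
  have : a ^+ 6 <= a by rewrite -[leRHS]expr1 ler_wiXn2l // ltW //; lra.
  lra.
have beta_le : beta <= 4 * a ^+ 12.
  have -> : 4 * a ^+ 12 = (2 * a ^+ 6) ^+ 2 by ring.
  by rewrite betaE' ler_wiXn2l // mulr_ge0 // exprn_ge0 // ltW.
have beta0 : 0 <= beta by rewrite betaE' exprn_ge0 // mulr_ge0 // exprn_ge0 // ltW.
have a12 : 4 * a ^+ 12 <= 2 * a ^+ 2.
  have : a ^+ 12 <= a ^+ 3 by rewrite ler_wiXn2l // ltW //; lra.
  have : a ^+ 3 <= a ^+ 2 / 16 by rewrite exprSr; have := exprn_gt0 2 a0; nra.
  have := exprn_gt0 2 a0; lra.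
have -> : n * beta / ((1 - tau') * n) = beta / (1 - tau').
  by field; rewrite !lt0r_neq0 //; lra.
have -> : 2 * a = a + a by ring.
apply: lerD.
  apply: (@le_trans _ _ (k%:R * (2 * a ^+ 2))).
    by rewrite ler_wpM2l ?(ltW k0) // (le_trans beta_le).
  nra.
rewrite ler_pdivrMr; last lra.
apply: le_trans beta_le _; apply: le_trans a12 _; nra.
Qed.

Lemma split_probability_ge0 (k : nat) (p : R) :
  (0 < k)%N -> 0 <= p <= 1 -> 0 <= 1 - p ^+ k - (1 - p) ^+ k.
Proof.
move=> k0; have le_id (x : R) : 0 <= x <= 1 -> x ^+ k <= x.
  by move=> /andP[x0 x1]; rewrite -[leRHS]expr1 ler_wiXn2l.
move=> p01; have := le_id _ p01.
have : (1 - p) ^+ k <= 1 - p.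
  by apply: le_id => //; rewrite subr_ge0 gerBl andbC.
lra.
Qed.

End Numerics.

Lemma block_density01 {R : realType} {n : nat} (q0 q1 : R) (b : {set 'I_n}) i j :
  0 <= q0 <= 1 -> 0 <= q1 <= 1 -> 0 <= block_density q0 q1 b i j <= 1.
Proof. by rewrite /block_density; case: ifP. Qed.

(** On a good graph every assignment of positive probability succeeds, so the inner sum over [f] is
    the full mass 1. *)
Lemma step_success_probability {R : realType} {n : nat} (q0 q1 eps tau' c : R)
    (b : {set 'I_n}) (P : {set {set 'I_n}}) (s : {set 'I_n}) (beta : R) :
  0 <= q0 <= 1 -> 0 <= q1 <= 1 -> q1 <= q0 -> 0 <= eps <= 2^-1 ->
  (0 < n)%N -> tau' < 1 -> finset.partition P [set: 'I_n]%SET ->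
  4 * (eps * n%:R) + 4 <= (q0 - q1) * (2 * (correct b P)%:R - n%:R) ->
  ~~ (s \subset b) -> ~~ [disjoint s & b] ->
  beta = 2 ^+ #|P| * expR (- (eps ^+ 2 * n%:R / 2)) ->
  #|s|%:R * beta + n%:R * beta / ((1 - tau') * n%:R) <= c ->
  1 - c <= \sum_g \sum_f
    (if tau' * n%:R <= (correct b (bins f))%:R then
       edge_pmf (block_density q0 q1 b) g * assignment_pmf R P g s f else 0).
Proof.
move=> q0_01 q1_01 q10 eps01 n0 tau1 Ppart sep sb disj betaE fail.
set w := block_density q0 q1 b.
have w01 i j : 0 <= w i j <= 1 by exact: block_density01.
have n0R : 0 < n%:R :> R by rewrite ltr0n.
(* Losing at most [(1 - tau') n] vertices leaves at least [tau' n] correct ones. *)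
have m0 : 0 < (1 - tau') * n%:R by rewrite mulr_gt0 // subr_gt0.
apply: le_trans (le_trans _ (good_graph_probability w01 (block_density_sym q0 q1 b)
  Ppart s eps01 m0 betaE)) _; first by rewrite lerD2l lerN2.
rewrite big_mkcond /=; apply: ler_sum => g _.
have g0 := edge_pmf_ge0 g w01.
have term0 f : 0 <= edge_pmf w g * assignment_pmf R P g s f.
  by rewrite mulr_ge0 // assignment_pmf_ge0.
case: ifP => [/andP[sgood few_bad]|_]; last first.
  by apply: sumr_ge0 => f _; case: ifP.
have s0 : s != finset.set0 by apply: contraNneq sb => ->; rewrite finset.sub0set.
rewrite -[leLHS]mulr1 -[X in _ * X <= _](sum_assignment_pmf P g s0) mulr_sumr.
apply: ler_sum => f _.
case: ifPn => // low.
have [->|f0] := eqVneq (assignment_pmf R P g s f) 0; first by rewrite mulr0.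
rewrite /edge_pmf; case: ifP => [gs|_]; last by rewrite mul0r.
case/negP: low.
have := correct_after_step q0_01 q10 Ppart gs sep f0 sgood sb disj.
rewrite -(ler_nat R) natrD => /le_trans/(_ (lerD (lexx _) few_bad)).
by rewrite mulrBl mul1r addrCA lerDl subr_ge0.
Qed.

(** * The random model *)

Lemma uniform_prob_subset {R : realType} (A : set R) :
  measurable A -> A `<=` unit_interval (R := R) ->
  uniform_prob (@ltr01 R) A = lebesgue_measure A.
Proof.
move=> mA A01; rewrite /uniform_prob.
rewrite (eq_integral (cst 1%E)) ?integral_cst ?mul1e // => x; rewrite inE => /A01.
by rewrite /unit_interval /= in_itv /= /uniform_pdf => ->; rewrite subr0 invr1.
Qed.

Section Model.
Context {R : realType} {d : measure_display} {T : measurableType d}.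
Context {Pr : probability T R} {n : nat} {U : 'I_n -> {RV Pr >-> R}}.

Lemma measurable_latent_in (D : 'I_n -> set R) :
  (forall i, measurable (D i)) -> measurable (latent_in U D).
Proof.
move=> mD; have -> : latent_in U D = \bigcap_(i in [set: 'I_n]) (U i @^-1` D i).
  by apply/seteqP; split=> w; [move=> h i _; exact: h|move=> h i; exact: h].
apply: fin_bigcap_measurable => [|i _]; first exact: finite_finset.
by rewrite -[X in measurable X]setTI; exact: measurable_funP.
Qed.

Lemma finite_rv_block (A : set R) :
  measurable A -> finite_rv (fun w => block (fun i => U i w) A).
Proof.
move=> mA b; have -> : (fun w => block (fun i => U i w) A) @^-1` [set b] =
    latent_in U (fun i => if i \in b then A else ~` A).
  apply/seteqP; split=> w /=.
    by move=> <- i; rewrite inE; case: ifPn => [/set_mem|/negP h /mem_set].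
  move=> h; apply/setP => i; rewrite inE; have := h i.
  by case: ifP => _ ?; [exact: mem_set|apply/negP => /set_mem].
by apply: measurable_latent_in => i; case: ifP => _ //; exact: measurableC.
Qed.

(** The event depends only on the two blocks and on [F], hence is a finite union of measurable
    fibres. *)
Lemma measurable_num_correct (A B : set R) (F : T -> {ffun 'I_n -> 'I_n}) (r : R) :
  measurable A -> measurable B -> finite_rv F ->
  measurable [set w | r <= (num_correct A B (fun i => U i w) (bins (F w)))%:R].
Proof.
move=> mA mB mF.
pose E (x : {set 'I_n} * {set 'I_n} * {ffun 'I_n -> 'I_n}) : set T :=
  (fun w => block (fun i => U i w) A) @^-1` [set x.1.1] `&`
  (fun w => block (fun i => U i w) B) @^-1` [set x.1.2] `&` F @^-1` [set x.2].
pose X := [set w | r <= (num_correct A B (fun i => U i w) (bins (F w)))%:R].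
have -> : [set w | r <= (num_correct A B (fun i => U i w) (bins (F w)))%:R] =
    \bigcup_(x in [set x | E x `&` X !=set0]) E x.
  apply/seteqP; split=> [w Xw|w [x [w' [[[a' b'] f'] Xw']] [[a b] f]]].
    pose x := (block (fun i => U i w) A, block (fun i => U i w) B, F w).
    by exists x => //; exists w.
  move: Xw'; rewrite /X /= /num_correct /majority.
  by rewrite a b f -a' -b' -f'.
apply: fin_bigcup_measurable => [|x _]; first exact: finite_finset.
by apply: measurableI; [apply: measurableI; exact: finite_rv_block|exact: mF].
Qed.

Variables (A B : set R) (p q0 q1 : R) (W : R -> R -> R).
Hypothesis sbm : sbm_graphon A B p q0 q1 W.

Let inAB u : A u \/ B u -> unit_interval u.
Proof. by rewrite -(sbm_cover sbm). Qed.

Let step (b : {set 'I_n}) (i : 'I_n) : set R := if i \in b then A else B.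

Let mstep b i : measurable (step b i).
Proof. by rewrite /step; case: ifP => _; [exact: sbm_measA sbm|exact: sbm_measB sbm]. Qed.

Lemma disjointAB u : A u -> B u -> False.
Proof. by move=> Au Bu; have : (A `&` B) u by []; rewrite (sbm_disjoint sbm). Qed.

Lemma block_step b w : latent_in U (step b) w ->
  block (fun i => U i w) A = b /\ block (fun i => U i w) B = (~: b)%SET.
Proof.
move=> h; split; apply/setP => i; rewrite !inE; have := h i; rewrite /step;
  case: ifP => _ hi /=.
- exact: mem_set.
- by apply/negP => /set_mem /disjointAB; exact.
- by apply/negP => /set_mem; exact: disjointAB.
- exact: mem_set.
Qed.

(** [W] is constant on products of steps, so the conditional law of the graph depends on the
    positions only through [b]. *)
Lemma graph_pmf_step b w g : latent_in U (step b) w ->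
  graph_pmf W (fun i => U i w) g = edge_pmf (block_density q0 q1 b) g.
Proof.
move=> h; rewrite /graph_pmf /edge_pmf.
have in01 i : unit_interval (U i w).
  by apply: inAB; have := h i; rewrite /step; case: ifP => _; [left|right].
have [hA hB] := block_step h.
have E i j : W (U i w) (U j w) = block_density q0 q1 b i j.
  rewrite (sbm_val sbm) // /block_density.
  have inA l : (U l w \in A) = (l \in b) by rewrite -hA inE.
  have inB l : (U l w \in B) = (l \notin b) by rewrite -finset.in_setC -hB inE.
  by rewrite !inA !inB; case: (i \in b); case: (j \in b).
case: ifP => // _; apply: eq_bigr => i _; apply: eq_bigr => j _; by rewrite E.
Qed.

Lemma probability_latent_step b : iid_uniform U ->
  Pr (latent_in U (step b)) = (block_weight p b)%:E.
Proof.
move=> [indep unif].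
have -> : latent_in U (step b) =
    \bigcap_(i in [set` [set: 'I_n]%SET]) (U i @^-1` step b i).
  apply/seteqP; split=> w; [by move=> h i _; exact: h|move=> h i; apply: h].
  by rewrite /= finset.in_setT.
rewrite indep //; transitivity (\prod_(i < n) (if i \in b then p else 1 - p)%:E)%E.
  apply: eq_big => [i|i _]; first by rewrite finset.in_setT.
  have := unif i (step b i) (mstep b i); rewrite /distribution /pushforward => ->.
  rewrite uniform_prob_subset //; last first.
    by move=> u su; apply: inAB; move: su; rewrite /step; case: ifP; [left|right].
  by rewrite /step; case: ifP => _; rewrite ?(sbm_sizeA sbm) ?(sbm_sizeB sbm).
by rewrite prodEFin.
Qed.

(** * Decomposition of the success event into cells *)

Variables (k : nat) (C : T -> {set {set 'I_n}}) (G : T -> 'M[bool]_n).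
Variables (S : T -> {set 'I_n}) (F : T -> {ffun 'I_n -> 'I_n}).
Hypothesis sampling : sampled_graph U C G W.
Hypothesis centroids : random_centroids U C G S k.
Hypothesis assignments : random_assignment U C G S F.

Let partition_event b P := latent_in U (step b) `&` C @^-1` [set P].

Let cell b P s g f :=
  partition_event b P `&` G @^-1` [set g] `&` S @^-1` [set s] `&` F @^-1` [set f].

Lemma measurable_partition_event b P : measurable (partition_event b P).
Proof. by apply: measurableI; [exact: measurable_latent_in|exact: sampling.1]. Qed.

Lemma measurable_cell b P s g f : measurable (cell b P s g f).
Proof.
have [mG _] := sampling.2; have [mS _] := centroids; have [mF _] := assignments.
have mPG := measurableI _ _ (measurable_partition_event b P) (mG g).
exact: measurableI (measurableI _ _ mPG (mS s)) (mF f).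
Qed.

(** The three conditional laws are chained; the integrand of the sampling identity is constant on
    the event. The joint law of blocks and partition stays abstract, as [C] may depend on [U]. *)
Lemma probability_cell b P s g f :
  Pr (cell b P s g f) = (fine (Pr (partition_event b P)) *
   (centroids_pmf R k s * (edge_pmf (block_density q0 q1 b) g *
     assignment_pmf R P g s f)))%:E.
Proof.
have mE := measurable_partition_event b P.
rewrite /cell (assignments.2 _ _ _ _ _ (mstep b)).
rewrite (centroids.2 _ _ _ _ (mstep b)) (sampling.2.2 _ _ _ (mstep b)).
have -> : (\int[Pr]_(w in partition_event b P) (graph_pmf W (fun i => U i w) g)%:E =
    (edge_pmf (block_density q0 q1 b) g)%:E * Pr (partition_event b P))%E.
  rewrite -(integral_cst Pr mE); apply: eq_integral => w.
  by rewrite inE => -[/graph_pmf_step ->].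
rewrite -(fineK (fin_num_measure Pr _ mE)) -!EFinM.
congr _%:E; ring.
Qed.

Lemma sum_partition_event b : iid_uniform U ->
  \sum_P fine (Pr (partition_event b P)) = block_weight p b.
Proof.
move=> iid; apply: EFin_inj; rewrite -probability_latent_step //.
have mE : measurable (latent_in U (step b)) by exact: measurable_latent_in.
rewrite -(sum_fibers Pr sampling.1 mE) -sumEFin; apply: eq_bigr => P _.
by rewrite fineK // fin_num_measure //; exact: measurable_partition_event.
Qed.

(** The number of correct vertices is constant on this event, which therefore lies in the
    exceptional null set. *)
Lemma partition_event_null b P (tau : R) :
  {ae Pr, forall w, tau * n%:R <= (num_correct A B (fun i => U i w) (C w))%:R} ->
  ~~ (tau * n%:R <= (correct b P)%:R) -> Pr (partition_event b P) = 0%E.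
Proof.
move=> ae_correct low; apply: measure_negligible.
  exact: measurable_partition_event.
apply: negligibleS ae_correct => w [/block_step[hA hB] /= ->] /=.
by rewrite (num_correct_blocks _ hA hB); exact/negP.
Qed.

(** The cells are disjoint, and those kept in the sum lie in the success event. An inequality
    suffices, so positions outside both steps may be ignored. *)
Lemma sum_cells_le_success (tau' : R) :
  ((\sum_b \sum_P \sum_s \sum_g \sum_f
     (if tau' * n%:R <= (correct b (bins f))%:R then
       fine (Pr (partition_event b P)) *
       (centroids_pmf R k s * (edge_pmf (block_density q0 q1 b) g *
         assignment_pmf R P g s f)) else 0))%:E
   <= Pr [set w | (tau' * n%:R <=
            (num_correct A B (fun i => U i w) (bins (F w)))%:R)%R])%E.
Proof.
rewrite !pair_bigA /= -big_mkcond /= -sumEFin.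
under eq_bigr do rewrite -probability_cell.
apply: sum_cells_le.
- apply: measurable_num_correct assignments.1.
    exact: sbm_measA sbm.
  exact: sbm_measB sbm.
- by move=> i; exact: measurable_cell.
- move=> [[[[b P] s] g] f] [[[[b' P'] s'] g'] f'] _ _ /= [w].
  move=> [[[[[/block_step[hA _] /= <-] <-] <-] <-]].
  move=> [[[[/block_step[hA' _] /= <-] <-] <-] <-].
  by rewrite -hA -hA'.
- move=> [[[[b P] s] g] f] /= ok w [[[[/block_step[hA hB] _] _] _] /= Ff].
  by rewrite Ff (num_correct_blocks _ hA hB).
Qed.


(** The conditional bound [c] is averaged over the centroids and the blocks; independence of the two
    yields the factor for both blocks containing a centroid. *)
Lemma success_probability (tau tau' c : R) :
  iid_uniform U -> (0 < k <= n)%N ->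
  {ae Pr, forall w, tau * n%:R <= (num_correct A B (fun i => U i w) (C w))%:R} ->
  (forall w, finset.partition (C w) [set: 'I_n]%SET /\ #|C w| = k) ->
  (forall (b : {set 'I_n}) P (s : {set 'I_n}),
     finset.partition P [set: 'I_n]%SET -> #|P| = k -> #|s| = k ->
     tau * n%:R <= (correct b P)%:R -> ~~ (s \subset b) -> ~~ [disjoint s & b] ->
     c <= \sum_g \sum_f
       (if tau' * n%:R <= (correct b (bins f))%:R then
          edge_pmf (block_density q0 q1 b) g * assignment_pmf R P g s f else 0)) ->
  (((1 - p ^+ k - (1 - p) ^+ k) * c)%:E
   <= Pr [set w | (tau' * n%:R <=
            (num_correct A B (fun i => U i w) (bins (F w)))%:R)%R])%E.
Proof.
move=> iid /andP[k0 kn] ae_correct Cpart step_ok.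
apply: le_trans (sum_cells_le_success tau'); rewrite lee_fin.
pose mixed (b s : {set 'I_n}) := ~~ (s \subset b) && ~~ [disjoint s & b].
pose pi b P := fine (Pr (partition_event b P)).
have pi0 b P : 0 <= pi b P by exact: fine_ge0.
(* Here summing over [P] first gives [block_weight p b], then summing over mixed [b] gives a value
   depending on [s] only through its size [k]. *)
apply: (@le_trans _ _ (\sum_b \sum_P \sum_s
    (if mixed b s then pi b P * centroids_pmf R k s * c else 0))).
  have -> : \sum_b \sum_P \sum_s
        (if mixed b s then pi b P * centroids_pmf R k s * c else 0) =
      \sum_s centroids_pmf R k s * c * \sum_(b | mixed b s) block_weight p b.
    under eq_bigr do rewrite exchange_big /=.
    rewrite exchange_big /=; apply: eq_bigr => s _.
    rewrite [in RHS]big_mkcond mulr_sumr; apply: eq_bigr => b _ /=.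
    case: ifP => _; last by rewrite mulr0 big1.
    rewrite -sum_partition_event // mulr_sumr; apply: eq_bigr => P _.
    by rewrite -mulrA mulrC.
  rewrite (eq_bigr (fun s => centroids_pmf R k s * (c * (1 - p ^+ k - (1 - p) ^+ k)))).
    by rewrite -mulr_suml sum_centroids_pmf // mul1r mulrC.
  move=> s _; rewrite /centroids_pmf; case: eqP => [sk|_]; last by rewrite !mul0r.
  rewrite -mulrA; congr (_ * (_ * _)); rewrite -sk sum_block_weight_split //.
  by rewrite -card_gt0 sk.
have edge0 b g : 0 <= edge_pmf (block_density q0 q1 b) g.
  apply: edge_pmf_ge0 => i j.
  by apply: block_density01; [exact: sbm_q0 sbm|exact: sbm_q1 sbm].
apply: ler_sum => b _; apply: ler_sum => P _; apply: ler_sum => s _.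
have term0 g f : 0 <= (if tau' * n%:R <= (correct b (bins f))%:R then
       pi b P * (centroids_pmf R k s * (edge_pmf (block_density q0 q1 b) g *
         assignment_pmf R P g s f)) else 0).
  case: ifP => // _; by rewrite !mulr_ge0 ?centroids_pmf_ge0 ?assignment_pmf_ge0.
case: ifP => [/andP[sb disj]|_]; last by apply: sumr_ge0 => g _; exact: sumr_ge0.
have [piz|piN] := eqVneq (pi b P) 0.
  by rewrite piz !mul0r; apply: sumr_ge0 => g _; exact: sumr_ge0.
have [kz|] := eqVneq (centroids_pmf R k s) 0.
  by rewrite [X in _ * X * _ <= _]kz mulr0 mul0r; apply: sumr_ge0 => g _; exact: sumr_ge0.
rewrite {1}/centroids_pmf; case: (#|s| =P k) => [sk _|_]; last by rewrite eqxx.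
have okP : tau * n%:R <= (correct b P)%:R.
  by apply: contraNT piN => low; rewrite /pi (partition_event_null ae_correct low).
(* An event of positive probability contains a point, through which the properties of [C] pass to
   [P]. *)
have [w [_ /= CwP]] : partition_event b P !=set0.
  by apply/set0P; apply: contraNneq piN => E; rewrite /pi E measure0.
have [Ppart Pk] := Cpart w; rewrite CwP in Ppart Pk.
have := step_ok b P s Ppart Pk sk okP sb disj.
have pk0 : 0 <= pi b P * centroids_pmf R k s by rewrite mulr_ge0 ?centroids_pmf_ge0.
move=> /(ler_wpM2l pk0) /le_trans; apply; rewrite le_eqVlt; apply/orP; left; apply/eqP.
rewrite mulr_sumr; apply: eq_bigr => g _; rewrite mulr_sumr; apply: eq_bigr => f _.
by case: ifP => _; rewrite ?mulr0 // -mulrA.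
Qed.

End Model.

(** * Combination of the estimates *)

Theorem theorem4p1 (R : realType) (A B : set R) (p q0 q1 : R)
  (W : R -> R -> R) (n k : nat)
  (d : measure_display) (T : measurableType d) (Pr : probability T R)
  (U : 'I_n -> {RV Pr >-> R}) (G : T -> 'M[bool]_n)
  (C : T -> {set {set 'I_n}}) (S : T -> {set 'I_n})
  (F : T -> {ffun 'I_n -> 'I_n}) (tau tau' : R) :
  sbm_graphon A B p q0 q1 W ->
  p <= 2^-1 ->
  q1 < q0 ->
  (2 <= k)%N ->
  iid_uniform U ->
  sampled_graph U C G W ->
  random_centroids U C G S k ->
  random_assignment U C G S F ->
  (forall w, finset.partition (C w) [set: 'I_n]%SET /\ #|C w| = k) ->
  1 - (4 * k%:R)^-1 < tau ->
  tau < 1 ->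
  {ae Pr, forall w,
     tau * n%:R <= (num_correct A B (fun i => U i w) (C w))%:R} ->
  tau < tau' ->
  forall eps xi : R,
  0 < eps ->
  0 < xi ->
  tau' + xi < 1 ->
  (3 - Num.sqrt (1 - 4 * k%:R * (1 - tau))) / tau - 2 + 4 * eps
    + (1 - Num.sqrt (1 - 4 * k%:R * (1 - tau))) / (n%:R * tau * (1 - tau))
    <= q0 - q1 ->
  - (12 * k%:R) * ln ((1 - (tau' + xi) `^ k%:R^-1) / 2) < eps ^+ 2 * n%:R ->
  (((1 - p ^+ k - (1 - p) ^+ k)
    * (1 - 2 * expR (- (eps ^+ 2 * n%:R / (12 * k%:R)))) ^+ (k ^ 2)
    * (1 - 2 * expR (- (xi ^+ 2 * n%:R / 3))))%:E
   <= Pr [set w | (tau' * n%:R <=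
            (num_correct A B (fun i => U i w) (bins (F w)))%:R)%R])%E.
Proof.
move=> sbm _ q10 k2 iid sampling centroids assignments Cpart tau_gt tau1 ae_correct
  tau_lt eps xi eps0 xi0 tauxi gap_ge eps_gt.
(* A sample point provides a partition into [k] non-empty classes, hence [k <= n]. *)
have [w _] : [set: T] !=set0.
  apply/set0P/eqP => T0; have := probability_setT Pr; rewrite T0 measure0 => /eqP.
  by rewrite eqe eq_sym oner_eq0.
have kn : (k <= n)%N by have [/card_partition_le + <-] := Cpart w.
have k0 : (0 < k)%N := ltnW k2.
have n0 : (0 < n)%N := leq_trans k0 kn.
have n0R : 0 < n%:R :> R by rewrite ltr0n.
have k2R : 2 <= k%:R :> R by rewrite ler_nat.
have gap := density_gap_lower_bound k2R n0R tau_gt tau1 gap_ge.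
set a := expR (- (eps ^+ 2 * n%:R / (12 * k%:R))).
have kinv : (4 * k%:R)^-1 <= 8^-1 :> R by rewrite lef_pV2 ?posrE //; lra.
have tau'0 : 0 < tau' by lra.
have a1 := failure_rate_bound k2 (erefl a) xi0 tau'0 tauxi eps_gt.
clear gap_ge eps_gt.
have /andP[q0_0 q0_1] := sbm_q0 sbm; have /andP[q1_0 q1_1] := sbm_q1 sbm.
have gap1 : q0 - q1 <= 1 by lra.
have n4 : 0 < 4 / n%:R :> R by rewrite divr_gt0.
(* The lower bound on the gap contains [4 eps], and the gap is at most 1. *)
have eps2 : 0 <= eps <= 2^-1 by apply/andP; split; lra.
have a0 : 0 < a by exact: expR_gt0.
have tau'_gt : 1 - (4 * k%:R)^-1 < tau' by exact: lt_trans tau_lt.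
have tau'1 : tau' < 1 by lra.
have p01 : 0 <= p <= 1.
  by rewrite -[p <= 1]subr_ge0 -!lee_fin -(sbm_sizeA sbm) -(sbm_sizeB sbm) !measure_ge0.
have mix0 := split_probability_ge0 k0 p01.
have c01 : 0 <= 1 - 2 * a <= 1 by apply/andP; split; lra.
(* The claimed bound is weaker than this one: [1 - 2 a] lies in [[0, 1]], so its power [k ^ 2] is no
   larger, and the last factor is at most 1. *)
apply: (@le_trans _ _ ((1 - p ^+ k - (1 - p) ^+ k) * (1 - 2 * a))%:E).
  rewrite lee_fin -mulrA ler_wpM2l //.
  have /andP[c0 c1] := c01.
  have ck : (1 - 2 * a) ^+ (k ^ 2) <= 1 - 2 * a.
    by rewrite -[leRHS]expr1 ler_wiXn2l // expn_gt0 k0.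
  by apply: le_trans ck; rewrite -[leRHS]mulr1 ler_wpM2l ?exprn_ge0.
apply: (success_probability sbm sampling centroids assignments (tau := tau)) => //.
  exact/andP.
move=> b P s Ppart Pk sk okP sb disj.
apply: (@step_success_probability _ _ _ _ eps _ _ _ _ _
          (2 ^+ #|P| * expR (- (eps ^+ 2 * n%:R / 2)))) => //.
- exact: sbm_q0 sbm.
- exact: sbm_q1 sbm.
- exact: ltW.
- by apply: separation_bound okP gap => //; exact: ltW.
- by rewrite sk Pk; apply: (failure_bound k2 n0R (erefl a)).
Qed.
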